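(* Let $b>a>0$. For each $s\in(0,1)$ let $\psi_s:\mathbb{R}\to[a,b]$ with $\psi_s(0)=1$, and let $f_s(x)=x^s\psi_s(\log x)$ (for $x>0$, extended by continuity at $0$) be such that $g_s(x)=-x^2f_s''(x)$ satisfies $g_s\ge0$ and $x^2g_s''(x)+g_s(\alpha)g_s(x/\alpha)\le0$ for all $x\ge0$, $\alpha>0$. Consider a memoryless channel $W_{Y|X}$ on finite alphabets $\mathcal{X},\mathcal{Y}$ with $W_{\min}=\min_{x,y}W_{Y|X}(y|x)>0$, used with blocklength $n$, a message set of size $|\mathcal{M}|=e^{nR}$, any encoder and decoder, and maximal error probability $P_e^{\max}=\max_m\Pr(\hat M\ne M\mid M=m)$. Let $G(x)=-\log(1-x)$ and $\tilde f_s(x)=x\big(1-f_s(1/x)\big)$, and define $$\mathtt{E}_{f\text{-}\mathrm{sp}}(R)=\sup_{p_X}\sup_{s\in(0,1)}\left[\frac{I_{G,\tilde f_s}(X;Y)}{1-s}-\frac{s}{1-s}R\right],$$ where $Y$ is the output of $W_{Y|X}$ with input $X\sim p_X$. Then for any positive rate $R$, $$P_e^{\max}>\exp\Big\{-n\Big(\mathtt{E}_{f\text{-}\mathrm{sp}}\big(R-\mathcal{O}(\tfrac1n)\big)+\mathcal{O}(\tfrac{1}{\sqrt n})\Big)\Big\},$$ where the $\mathcal{O}$ terms refer to $n\to\infty$ with implied constants not depending on the code. Consequently the error exponent satisfies $\mathscr{E}(R)\le \mathtt{E}_{f\text{-}\mathrm{sp}}(R)$.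
   Context: For distributions $p\ll q$ on a finite set and a function $h$ on $[0,\infty)$, $D_h(p\|q)=\sum_y q(y)h(p(y)/q(y))$ with $0h(0/0)=0$. For random variables $X,Y$ on finite sets, $I_{G,h}(X;Y)=\min_{q_Y}\sum_x p_X(x)\,G(D_h(p_{Y|X=x}\|q_Y))$. The error exponent is $\mathscr{E}(R)=\limsup -\frac{1}{n}\log P_e^{\max}$, the limsup taken over codes of rate $R$ as $n\to\infty$. *)

(* Defs.v *)
From HB Require Import structures.
From mathcomp Require Import all_boot all_order all_algebra.
From mathcomp Require Import all_classical all_reals all_analysis.
Set Implicit Arguments. Unset Strict Implicit. Unset Printing Implicit Defensive.
Import Order.TTheory GRing.Theory Num.Theory.
Local Open Scope ring_scope.
Local Open Scope classical_set_scope.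

Section Defs.
Variable R : realType.

Definition is_dist (T : finType) (p : T -> R) : Prop :=
  (forall t, 0 <= p t) /\ \sum_(t : T) p t = 1.

Definition abscont (T : finType) (p q : T -> R) : Prop :=
  forall t, q t = 0 -> p t = 0.

(* D_h(p||q) = sum_y q(y) h(p(y)/q(y)), with the convention 0 h(0/0) = 0
   (meaningful for p << q) *)
Definition Dh (T : finType) (h : R -> R) (p q : T -> R) : R :=
  \sum_(y : T) (if q y == 0 then 0 else q y * h (p y / q y)).

(* I_{G,h}(X;Y) with X ~ pX and Y the output of channel W;
   min over q_Y (written as an infimum), over those q_Y dominating every
   conditional law p_{Y|X=x} = W x with pX x > 0 *)
Definition IGh (X Y : finType) (G h : R -> R) (pX : X -> R) (W : X -> Y -> R)
  : \bar R :=
  ereal_inf [set (\sum_(x : X) pX x * G (Dh h (W x) q))%:E | q in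
     [set q : Y -> R | is_dist q /\ (forall x, 0 < pX x -> abscont (W x) q)]].

Definition Gfun (x : R) : R := - ln (1 - x).

(* f_s(x) = x^s psi_s(log x)  (for x = 0 this evaluates to 0, the continuous
   extension, since 0 `^ s = 0 for s > 0) *)
Definition fs (psi : R -> R -> R) (s : R) (x : R) : R := powR x s * psi s (ln x).

Definition gs (psi : R -> R -> R) (s : R) (x : R) : R :=
  - (x ^+ 2 * derive1n 2 (fs psi s) x).

Definition ftilde (psi : R -> R -> R) (s : R) (x : R) : R :=
  x * (1 - fs psi s x^-1).

Definition Efsp (X Y : finType) (psi : R -> R -> R) (W : X -> Y -> R) (Rate : R)
  : \bar R :=
  ereal_sup [set e : \bar R | exists (pX : X -> R) (s : R),
      [/\ is_dist pX, 0 < s < 1 &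
       e = (((1 - s)^-1)%:E * IGh Gfun (ftilde psi s) pX W
              - (s / (1 - s) * Rate)%:E)%E]].

Definition Pe_m (X Y : finType) (W : X -> Y -> R) (n N : nat)
  (enc : 'I_N -> {ffun 'I_n -> X}) (dec : {ffun 'I_n -> Y} -> 'I_N) (m : 'I_N) : R :=
  \sum_(y : {ffun 'I_n -> Y} | dec y != m) \prod_(i < n) W (enc m i) (y i).

Definition Pemax (X Y : finType) (W : X -> Y -> R) (n N : nat)
  (enc : 'I_N -> {ffun 'I_n -> X}) (dec : {ffun 'I_n -> Y} -> 'I_N) : R :=
  \big[Num.max/0]_(m < N) Pe_m W enc dec m.

Definition best_exp (X Y : finType) (W : X -> Y -> R) (Rate : R) (n : nat) : \bar R :=
  ereal_sup [set e : \bar R | exists (N : nat) (enc : 'I_N -> {ffun 'I_n -> X})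
      (dec : {ffun 'I_n -> Y} -> 'I_N),
      expR (n%:R * Rate) <= N%:R /\ e = (- ln (Pemax W enc dec) / n%:R)%:E].

Definition err_exp (X Y : finType) (W : X -> Y -> R) (Rate : R) : \bar R :=
  limn_esup (best_exp W Rate).
End Defs.

(* Main.v *)
(** The condition on [g_s] says that for mean-one positive variables
    [E f_s(XX') >= E f_s(X) E f_s(X')]: the functions [g(t) f(x) - g(tx)] and
    then [E f(xX') - f(x) E f(X')] are convex in [x], so Jensen applies twice.
    Tensorizing [n] times and using [f_s <= b x^s] gives
    [E f_s(X) <= E X^s], so [E_{f-sp}] dominates the classical sphere-packing
    exponent, and it suffices to prove the latter bound.

    For a code, a [1/poly(n)] fraction of the messages shares one type [P].  Let
    [V] be a channel with [I(P,V)] slightly below the rate and [q] its output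
    law.  Some decoding region of that fraction is small for [q^n]; two
    Chebyshev bounds make it small for [V^n], and changing measure to [W^n]
    bounds its error from below by [exp(-n D(V||W|P) - O(sqrt n))].  Lagrangian
    duality for [min {D(V||W|P) : I(P,V) <= r}] gives a multiplier
    [rho = s/(1-s)], and the Gibbs variational formula turns the dual value into
    the infimum over output laws that defines [I_{G,h}].  The slope [rho] stays bounded as
    [W_min > 0] and the rate is positive, so the [O(1/sqrt n)] loss in rate is
    only an [O(1/sqrt n)] loss in exponent, and [C1 = 0] will do. *)
Require Import Defs.
From HB Require Import structures.
From mathcomp Require Import all_boot all_order all_algebra.
From mathcomp Require Import all_classical all_reals all_analysis.
From mathcomp Require Import ring lra.
Set Implicit Arguments. Unset Strict Implicit. Unset Printing Implicit Defensive.
Import Order.TTheory GRing.Theory Num.Theory.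
Import numFieldNormedType.Exports.
Local Open Scope ring_scope.
Local Open Scope classical_set_scope.

(** * Tensorization of the f-divergence *)

Section Jensen.
Context {R : realType}.
Implicit Types (K : R -> R) (T : finType).

Lemma mvt_pos (K K1 : R -> R) (x y : R) :
  (forall z : R, 0 < z -> is_derive z 1 K (K1 z)) ->
  0 < x -> x < y -> exists2 z, x < z < y & K y - K x = K1 z * (y - x).
Proof.
move=> dK x0 xy.
have [||z] := @MVT _ K K1 _ _ xy.
- by move=> z; rewrite in_itv/= => /andP[xz _]; apply: dK; exact: lt_trans xz.
- apply: derivable_within_continuous => z; rewrite in_itv/= => /andP[xz _].
  by have [] := dK z (lt_le_trans x0 xz).
- by rewrite in_itv/= => xzy ->; exists z.
Qed.

(** A nonnegative second derivative makes [K1] monotone, and the mean value theorem then compares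
    [K] with its tangent. The base point is 1 because Jensen is applied to variables of mean one. *)
Lemma tangent_at1_le (K K1 K2 : R -> R) (x : R) :
  (forall z : R, 0 < z -> is_derive z 1 K (K1 z)) ->
  (forall z : R, 0 < z -> is_derive z 1 K1 (K2 z)) ->
  (forall z : R, 0 < z -> 0 <= K2 z) ->
  0 < x -> K 1 + K1 1 * (x - 1) <= K x.
Proof.
move=> dK dK1 K20 x0.
have K1_nd (y z : R) : 0 < y -> y < z -> K1 y <= K1 z.
  move=> y0 yz; have [c /andP[yc _] e] := mvt_pos dK1 y0 yz.
  rewrite -subr_ge0 e mulr_ge0// ?subr_ge0 ?(ltW yz)//.
  by apply: K20; exact: lt_trans yc.
have [x1|x1|->] := ltgtP x 1.
- have [c /andP[xc c1] e] := mvt_pos dK x0 x1.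
  have := K1_nd c 1 (lt_trans x0 xc) c1; nra.
- have [c /andP[c1 cx] e] := mvt_pos dK ltr01 x1.
  have := K1_nd 1 c ltr01 c1; nra.
- by rewrite subrr mulr0 addr0.
Qed.

Lemma jensen_pos T (p v : T -> R) (K K1 K2 : R -> R) :
  (forall z : R, 0 < z -> is_derive z 1 K (K1 z)) ->
  (forall z : R, 0 < z -> is_derive z 1 K1 (K2 z)) ->
  (forall z : R, 0 < z -> 0 <= K2 z) ->
  is_dist p -> (forall y, 0 < v y) -> \sum_y p y * v y = 1 ->
  K 1 <= \sum_y p y * K (v y).
Proof.
move=> dK dK1 K20 [p0 p1] v0 pv.
apply: (@le_trans _ _ (\sum_y p y * (K 1 + K1 1 * (v y - 1)))); last first.
  by apply: ler_sum => y _; rewrite ler_wpM2l// (tangent_at1_le dK dK1).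
rewrite (eq_bigr (fun y => (K 1 - K1 1) * p y + K1 1 * (p y * v y))); last first.
  by move=> y _; ring.
rewrite big_split/= -!mulr_sumr p1 pv; lra.
Qed.

Lemma expect_gt0 T (p v : T -> R) :
  is_dist p -> (forall y, 0 < v y) -> 0 < \sum_y p y * v y.
Proof.
move=> [p0 p1] v0.
have pv0 y : 0 <= p y * v y by rewrite mulr_ge0// ltW.
rewrite lt_neqAle sumr_ge0// andbT; apply/eqP => /esym/eqP.
rewrite psumr_eq0// => /allP h.
have : \sum_y p y = 0.
  rewrite big1// => y _; have := h y (mem_index_enum y).
  by rewrite mulf_eq0 (gt_eqF (v0 y)) orbF => /eqP.
by rewrite p1 => /eqP; rewrite oner_eq0.
Qed.

Lemma is_derive_fsum T (h : T -> R -> R) (dh : T -> R) (x : R) :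
  (forall y, is_derive x 1 (h y) (dh y)) ->
  is_derive x 1 (fun z => \sum_y h y z) (\sum_y dh y).
Proof.
move=> hP; elim: (index_enum T) => [|y r IH].
  by under eq_fun do rewrite big_nil; rewrite big_nil; exact: is_derive_cst.
by under eq_fun do rewrite big_cons; rewrite big_cons; exact: is_deriveD.
Qed.

Lemma is_derive_dilate (h : R -> R) (c d x : R) :
  is_derive (c * x) 1 h d -> is_derive x 1 (fun z => h (c * z)) (c * d).
Proof.
move=> hd; rewrite mulrC.
have := @is_deriveZ _ _ _ id c x 1 1 _.
rewrite scaler1 => hc.
exact: (@is_derive1_comp _ h ( *%R c)).
Qed.

End Jensen.

Section Tensorization.
Context {R : realType}.
Variables (f f1 f2 g g1 g2 : R -> R).
Hypothesis df : forall x : R, 0 < x -> is_derive x 1 f (f1 x).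
Hypothesis df1 : forall x : R, 0 < x -> is_derive x 1 f1 (f2 x).
Hypothesis dg : forall x : R, 0 < x -> is_derive x 1 g (g1 x).
Hypothesis dg1 : forall x : R, 0 < x -> is_derive x 1 g1 (g2 x).
Hypothesis gE : forall x : R, 0 < x -> g x = - (x ^+ 2 * f2 x).
Hypothesis g_ineq : forall x c : R, 0 < x -> 0 < c ->
  x ^+ 2 * g2 x + g c * g (x / c) <= 0.
Hypothesis f_1 : f 1 = 1.

(** Jensen for [K x = g t * f x - g (t * x)], which vanishes at 1. It is convex because
    [x ^+ 2 * K2 x] is [- (g t * g x + (t * x) ^+ 2 * g2 (t * x))], whose sign is [g_ineq] at
    [t * x] and [t]. *)
Lemma expect_dilated_g_le (T : finType) (p v : T -> R) (t : R) :
  is_dist p -> (forall y, 0 < v y) -> \sum_y p y * v y = 1 -> 0 < t ->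
  \sum_y p y * g (t * v y) <= g t * \sum_y p y * f (v y).
Proof.
move=> pd v0 pv t0.
pose K x := g t * f x - g (t * x).
pose K1 x := g t * f1 x - t * g1 (t * x).
pose K2 x := g t * f2 x - t * (t * g2 (t * x)).
have dK (x : R) : 0 < x -> is_derive x 1 K (K1 x).
  move=> x0; apply: is_deriveB; first exact: (@is_deriveZ _ _ _ f (g t) x 1 _ (df x0)).
  by apply: is_derive_dilate; apply: dg; rewrite mulr_gt0.
have dK1 (x : R) : 0 < x -> is_derive x 1 K1 (K2 x).
  move=> x0; apply: is_deriveB; first exact: (@is_deriveZ _ _ _ f1 (g t) x 1 _ (df1 x0)).
  apply: (@is_deriveZ _ _ _ (fun z => g1 (t * z)) t).
  by apply: is_derive_dilate; apply: dg1; rewrite mulr_gt0.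
have K20 x : 0 < x -> 0 <= K2 x.
  move=> x0; have := g_ineq (mulr_gt0 t0 x0) t0.
  rewrite [t * x / t]mulrAC mulfV ?gt_eqF// mul1r [g x]gE// => h.
  rewrite -(pmulr_rge0 _ (exprn_gt0 2 x0)) /K2; nra.
have := jensen_pos dK dK1 K20 pd v0 pv.
rewrite {1}/K f_1 !mulr1 subrr.
rewrite (eq_bigr (fun y => g t * (p y * f (v y)) - p y * g (t * v y))); last first.
  by move=> y _; rewrite /K; ring.
by rewrite sumrB -mulr_sumr subr_ge0.
Qed.

(** Jensen for the mean of [f (v' * x)] minus [f x] times the mean of [f v']. This vanishes at 1,
    and its convexity is the bound of [expect_dilated_g_le]. *)
Lemma expect_f_supermul (T T' : finType) (p v : T -> R) (p' v' : T' -> R) :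
  is_dist p -> (forall y, 0 < v y) -> \sum_y p y * v y = 1 ->
  is_dist p' -> (forall y, 0 < v' y) -> \sum_y p' y * v' y = 1 ->
  (\sum_y p y * f (v y)) * (\sum_y p' y * f (v' y)) <=
  \sum_y p y * \sum_z p' z * f (v y * v' z).
Proof.
move=> pd v0 pv pd' v0' pv'.
set E := \sum_y p' y * f (v' y).
pose K x := \sum_z p' z * f (v' z * x) - E * f x.
pose K1 x := \sum_z p' z * (v' z * f1 (v' z * x)) - E * f1 x.
pose K2 x := \sum_z p' z * (v' z * (v' z * f2 (v' z * x))) - E * f2 x.
have dK (x : R) : 0 < x -> is_derive x 1 K (K1 x).
  move=> x0; apply: is_deriveB; last exact: (@is_deriveZ _ _ _ f E x 1 _ (df x0)).
  apply: (@is_derive_fsum _ _ (fun z x => p' z * f (v' z * x))) => z.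
  apply: (@is_deriveZ _ _ _ (fun x => f (v' z * x)) (p' z)).
  by apply: is_derive_dilate; apply: df; rewrite mulr_gt0.
have dK1 (x : R) : 0 < x -> is_derive x 1 K1 (K2 x).
  move=> x0; apply: is_deriveB; last exact: (@is_deriveZ _ _ _ f1 E x 1 _ (df1 x0)).
  apply: (@is_derive_fsum _ _ (fun z x => p' z * (v' z * f1 (v' z * x)))) => z.
  apply: (@is_deriveZ _ _ _ (fun x => v' z * f1 (v' z * x)) (p' z)).
  apply: (@is_deriveZ _ _ _ (fun x => f1 (v' z * x)) (v' z)).
  by apply: is_derive_dilate; apply: df1; rewrite mulr_gt0.
have K20 x : 0 < x -> 0 <= K2 x.
  move=> x0; have := expect_dilated_g_le pd' v0' pv' x0.
  rewrite -/E (gE x0) => h.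
  rewrite -(pmulr_rge0 _ (exprn_gt0 2 x0)) /K2 mulrBr mulr_sumr.
  rewrite (eq_bigr (fun z => - (p' z * g (x * v' z)))); last first.
    by move=> z _; rewrite gE ?mulr_gt0// [x * v' z]mulrC; ring.
  rewrite sumrN; nra.
have := jensen_pos dK dK1 K20 pd v0 pv.
rewrite {1}/K f_1 mulr1.
rewrite (eq_bigr (fun z => p' z * f (v' z))); last by move=> z _; rewrite mulr1.
rewrite -/E subrr.
rewrite (eq_bigr (fun y => p y * \sum_z p' z * f (v y * v' z)
                           - E * (p y * f (v y)))); last first.
  move=> y _; rewrite /K mulrBr; congr (_ - _); last by ring.
  by congr (_ * _); apply: eq_bigr => z _; rewrite [v' z * _]mulrC.
by rewrite sumrB -mulr_sumr subr_ge0 mulrC.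
Qed.

(** The product space is built by pairing in one factor at a time: [powR] multiplies exactly, [f] by
    [expect_f_supermul]. *)
Lemma expect_f_power (T : finType) (p v : T -> R) (s : R) (n : nat) :
  (forall x : R, 0 < x -> 0 <= f x) ->
  is_dist p -> (forall y, 0 < v y) -> \sum_y p y * v y = 1 ->
  exists (U : finType) (q w : U -> R),
    [/\ is_dist q, (forall y, 0 < w y), \sum_y q y * w y = 1,
        \sum_y q y * powR (w y) s = (\sum_y p y * powR (v y) s) ^+ n &
        (\sum_y p y * f (v y)) ^+ n <= \sum_y q y * f (w y)].
Proof.
move=> f0 pd v0 pv; elim: n => [|n [U [q [w [qd w0 qw qs qf]]]]].
  exists unit, (fun=> 1), (fun=> 1).
  by split=> //; first (split=> //);
    rewrite !big_const card_unit/= ?powR1 ?f_1 ?mulr1 ?addr0.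
have [[q0 q1] [p0 p1]] := (qd, pd).
have pairM (h k : _ -> R) :
    \sum_(u : U * T) q u.1 * p u.2 * (h u.1 * k u.2) =
    (\sum_u q u * h u) * (\sum_y p y * k y).
  rewrite big_distrlr/= pair_big/=; apply: eq_bigr => u _; ring.
exists (U * T)%type, (fun u => q u.1 * p u.2), (fun u => w u.1 * v u.2); split.
- split=> [u|]; first exact: mulr_ge0.
  have := pairM (fun=> 1) (fun=> 1).
  rewrite [X in _ = X * _](eq_bigr q); last by move=> u _; rewrite mulr1.
  rewrite [X in _ = _ * X](eq_bigr p); last by move=> u _; rewrite mulr1.
  rewrite q1 p1 mulr1 => <-; apply: eq_bigr => u _; by rewrite !mulr1.
- by move=> u; rewrite mulr_gt0.
- by rewrite pairM qw pv mulr1.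
- rewrite exprSr -qs -pairM; apply: eq_bigr => u _.
  by rewrite powRM// ltW.
- rewrite exprSr.
  apply: (@le_trans _ _ ((\sum_y q y * f (w y)) * \sum_y p y * f (v y))).
    by rewrite ler_wpM2r// sumr_ge0// => y _; rewrite mulr_ge0// f0.
  apply: (le_trans (expect_f_supermul qd w0 qw pd v0 pv)).
  rewrite le_eqVlt; apply/orP; left; apply/eqP.
  under eq_bigr do rewrite mulr_sumr.
  rewrite pair_big/=; apply: eq_bigr => u _; ring.
Qed.

(* Tensorizing n times and taking n-th roots removes the factor b. *)
Lemma expect_f_le_powR (T : finType) (p v : T -> R) (s b : R) :
  (forall x : R, 0 < x -> 0 <= f x <= b * powR x s) ->
  is_dist p -> (forall y, 0 < v y) -> \sum_y p y * v y = 1 ->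
  \sum_y p y * f (v y) <= \sum_y p y * powR (v y) s.
Proof.
move=> fb pd v0 pv; rewrite leNgt; apply/negP => lt_sf.
have f0 (x : R) : 0 < x -> 0 <= f x by move=> /fb /andP[].
set A := \sum_y p y * powR (v y) s in lt_sf.
set B := \sum_y p y * f (v y) in lt_sf.
have A0 : 0 < A by apply: expect_gt0 => // y; exact: powR_gt0.
have BnA n : B ^+ n <= b * A ^+ n.
  have [U [q [w [[q0 q1] w0 qw <- le1]]]] := expect_f_power s n f0 pd v0 pv.
  apply: (le_trans le1); rewrite mulr_sumr; apply: ler_sum => u _.
  by rewrite mulrCA ler_wpM2l//; have /andP[] := fb _ (w0 u).
(* If [d > 0], Bernoulli's inequality pushes [(B / A) ^+ n] past [b]. *)
pose d := B / A - 1.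
have d0 : 0 < d by rewrite subr_gt0 ltr_pdivlMr// mul1r.
have bern n : 1 + n%:R * d <= (1 + d) ^+ n.
  elim: n => [|n IH]; first by rewrite mul0r addr0 expr0.
  rewrite exprSr -natr1; apply: (@le_trans _ _ ((1 + n%:R * d) * (1 + d))).
    by have : 0 <= n%:R :> R := ler0n _ _; nra.
  by rewrite ler_wpM2r//; lra.
have bound n : n%:R * d <= b.
  have : (1 + d) ^+ n <= b.
    rewrite /d addrC subrK expr_div_n ler_pdivrMr ?exprn_gt0//.
  by have := bern n; lra.
have := bound (Num.truncn (b / d)).+1; apply/negP; rewrite -ltNge.
by rewrite -ltr_pdivrMr// truncnS_gt.
Qed.

End Tensorization.

(** * Divergences and Lagrangian duality *)

Section Divergence.
Context {R : realType}.

Lemma ln_le_subr1 (x : R) : 0 < x -> ln x <= x - 1.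
Proof.
move=> x0; have := @le_ln1Dx R (x - 1).
by rewrite addrCA subrr addr0; apply; lra.
Qed.

(** With [r] the square root of [x], [- (r * ln r) <= 1 - r <= 1]; squaring gives the bound. It
    controls second moments of log-likelihoods even for probabilities close to 0. *)
Lemma sqr_ln_le (x : R) : 0 < x <= 1 -> x * ln x ^+ 2 <= 4.
Proof.
move=> /andP[x0 x1].
set r := Num.sqrt x; have r0 : 0 < r by rewrite sqrtr_gt0.
have xE : x = r ^+ 2 by rewrite sqr_sqrtr// ltW.
have : ln r^-1 <= r^-1 - 1 by apply: ln_le_subr1; rewrite invr_gt0.
rewrite lnV ?posrE// => h.
have ln0 : ln r <= 0 by apply: ln_le0; rewrite -sqrtr1 ler_wsqrtr.
have rln : - (r * ln r) <= 1.
  rewrite -mulrN; apply: (@le_trans _ _ (r * (r^-1 - 1))).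
    by rewrite ler_pM2l.
  by rewrite mulrBr divff ?gt_eqF//; lra.
have rln0 : 0 <= - (r * ln r) by rewrite -mulrN mulr_ge0 ?oppr_ge0// ltW.
rewrite xE lnXn//.
rewrite (_ : r ^+ 2 * _ = 4 * (- (r * ln r)) ^+ 2); last by rewrite -mulr_natr; ring.
have : (- (r * ln r)) ^+ 2 <= 1 by rewrite expr_le1.
lra.
Qed.

Definition kl (T : finType) (p q : T -> R) : R := \sum_y p y * ln (p y / q y).

Definition pos_dist (T : finType) (p : T -> R) : Prop :=
  (forall y, 0 < p y) /\ \sum_y p y = 1.

Lemma pos_distW (T : finType) (p : T -> R) : pos_dist p -> is_dist p.
Proof. by move=> [p0 p1]; split=> // y; exact: ltW. Qed.

Lemma dist_le1 (T : finType) (p : T -> R) y : is_dist p -> p y <= 1.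
Proof.
by move=> [p0 <-]; rewrite (bigD1 y)//= lerDl sumr_ge0.
Qed.

Lemma kl_ge0 (T : finType) (p q : T -> R) :
  pos_dist p -> pos_dist q -> 0 <= kl p q.
Proof.
move=> [p0 p1] [q0 q1].
apply: (@le_trans _ _ (\sum_y (p y - q y))); first by rewrite sumrB p1 q1 subrr.
apply: ler_sum => y _.
have := @ln_le_subr1 (q y / p y); rewrite divr_gt0// => /(_ isT).
rewrite -[q y / p y]invf_div lnV ?posrE ?divr_gt0// invf_div => h.
have := ler_wpM2l (ltW (p0 y)) h.
rewrite mulrBr mulr1 mulrCA mulfV ?gt_eqF// mulr1; lra.
Qed.

(* Joint convexity of the perspective [(x, y) |-> x ln (x / y)]. *)
Lemma log_sum2 (t x1 x2 y1 y2 : R) : 0 <= t <= 1 ->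
  0 < x1 -> 0 < x2 -> 0 < y1 -> 0 < y2 ->
  (t * x1 + (1 - t) * x2) *
    ln ((t * x1 + (1 - t) * x2) / (t * y1 + (1 - t) * y2))
  <= t * (x1 * ln (x1 / y1)) + (1 - t) * (x2 * ln (x2 / y2)).
Proof.
move=> /andP[t0 t1] x10 x20 y10 y20.
pose x := t * x1 + (1 - t) * x2; pose y := t * y1 + (1 - t) * y2.
rewrite -/x -/y.
have conv_gt0 (u v : R) : 0 < u -> 0 < v -> 0 < t * u + (1 - t) * v.
  by move=> u0 v0; nra.
have x0 : 0 < x by exact: conv_gt0.
have y0 : 0 < y by exact: conv_gt0.
(* The tangent plane at [(x, y)] lies below the perspective function; its correction terms cancel in
   the mixture. *)
have key (u v : R) : 0 < u -> 0 < v ->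
    u * ln (x / y) <= u * ln (u / v) + (x / y * v - u).
  move=> u0 v0; have := @ln_le_subr1 ((x / y) / (u / v)).
  rewrite !divr_gt0// => /(_ isT).
  rewrite ln_div ?posrE ?divr_gt0// => h.
  have := ler_wpM2l (ltW u0) h.
  rewrite (_ : u * (x / y / (u / v) - 1) = x / y * v - u); last first.
    by field; rewrite !gt_eqF.
  by rewrite mulrBr; lra.
have h1 := ler_wpM2l t0 (key _ _ x10 y10).
have t1' : 0 <= 1 - t by lra.
have h2 := ler_wpM2l t1' (key _ _ x20 y20).
have h3 : t * (x / y * y1 - x1) + (1 - t) * (x / y * y2 - x2) = 0.
  have : x / y * y = x by rewrite divfK// gt_eqF.
  move: (x / y) => z; rewrite /x /y; lra.
have -> : x * ln (x / y) = t * (x1 * ln (x / y)) + (1 - t) * (x2 * ln (x / y)).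
  by rewrite {1}/x; ring.
move: h1 h2; rewrite !mulrDr; lra.
Qed.

(* The Gibbs variational formula: [v] is the tilted law attaining the minimum of
   the left-hand side. *)
Lemma kl_tilt (T : finType) (p q : T -> R) (s : R) :
  0 < s < 1 -> pos_dist p -> pos_dist q ->
  exists2 v, pos_dist v &
  kl v p + s / (1 - s) * kl v q =
    (1 - s)^-1 * - ln (\sum_y p y * powR (q y / p y) s).
Proof.
move=> /andP[s0 s1] [p0 p1] [q0 q1].
set Z := \sum_y _.
have t0 y : 0 < p y * powR (q y / p y) s.
  by rewrite mulr_gt0// powR_gt0// divr_gt0.
have Z0 : 0 < Z.
  by apply: expect_gt0 => [|y]; [exact: pos_distW|rewrite powR_gt0// divr_gt0].
pose v y := p y * powR (q y / p y) s / Z.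
have v0 y : 0 < v y by rewrite divr_gt0.
have v1 : \sum_y v y = 1 by rewrite -mulr_suml divff// gt_eqF.
exists v; first by split.
have s1' : 1 - s != 0 by rewrite gt_eqF// subr_gt0.
rewrite /kl mulr_sumr -big_split/=.
rewrite (eq_bigr (fun y => (1 - s)^-1 * - ln Z * v y)).
  by rewrite -mulr_sumr v1 mulr1.
move=> y _.
have qp0 : 0 < q y / p y by rewrite divr_gt0.
have -> : ln (v y / p y) = s * ln (q y / p y) - ln Z.
  rewrite /v (_ : _ / _ / p y = powR (q y / p y) s / Z); last first.
    by field; rewrite !gt_eqF.
  by rewrite ln_div ?posrE ?powR_gt0// ln_powR.
have -> : ln (v y / q y) = s * ln (q y / p y) - ln Z - ln (q y / p y).
  rewrite /v (_ : _ / _ / q y = powR (q y / p y) s / Z / (q y / p y)); last first.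
    by field; rewrite !gt_eqF.
  by rewrite !ln_div ?posrE ?divr_gt0 ?powR_gt0// ln_powR ln_div ?posrE.
by field.
Qed.

End Divergence.

(** * Conditional divergence and mutual information *)

Section ConditionalDivergence.
Context {R : realType} (X Y : finType).
Variable P : X -> R.
Hypothesis Pd : is_dist P.
Implicit Types V W : X -> Y -> R.

(** The conditional divergence D(V||W|P). *)
Definition ckl V W : R := \sum_x P x * kl (V x) (W x).

Definition outd V (y : Y) : R := \sum_x P x * V x y.

Definition mutinf V : R := ckl V (fun=> outd V).

Definition pos_chan V : Prop := forall x, pos_dist (V x).

Definition mixch (t : R) V V' : X -> Y -> R :=
  fun x y => t * V x y + (1 - t) * V' x y.

Lemma outd_pos V : pos_chan V -> pos_dist (outd V).
Proof.
move=> Vd; have [P0 P1] := Pd; split=> [y|]; last first.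
  rewrite exchange_big/= -[RHS]P1; apply: eq_bigr => x _.
  by rewrite -mulr_sumr (Vd x).2 mulr1.
by apply: expect_gt0 => // x; exact: (Vd x).1.
Qed.

Lemma ckl_ge0 V W : pos_chan V -> pos_chan W -> 0 <= ckl V W.
Proof.
by move=> Vd Wd; apply: sumr_ge0 => x _; rewrite mulr_ge0 ?kl_ge0//; apply: Pd.1.
Qed.

Lemma mixch_pos t V V' : 0 <= t <= 1 ->
  pos_chan V -> pos_chan V' -> pos_chan (mixch t V V').
Proof.
move=> /andP[t0 t1] Vd Vd' x; split=> [y|].
  have := (Vd x).1 y; have := (Vd' x).1 y; rewrite /mixch; nra.
by rewrite /mixch big_split/= -!mulr_sumr (Vd x).2 (Vd' x).2; lra.
Qed.

Lemma ckl_mix t V V' W W' : 0 <= t <= 1 ->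
  pos_chan V -> pos_chan V' -> pos_chan W -> pos_chan W' ->
  ckl (mixch t V V') (mixch t W W') <= t * ckl V W + (1 - t) * ckl V' W'.
Proof.
move=> t01 Vd Vd' Wd Wd'.
rewrite /ckl !mulr_sumr -big_split/=; apply: ler_sum => x _.
rewrite [t * _]mulrCA [(1 - t) * _]mulrCA -mulrDr ler_wpM2l//; first exact: Pd.1.
rewrite /kl !mulr_sumr -big_split/=; apply: ler_sum => y _.
by apply: log_sum2 => //;
  [exact: (Vd x).1|exact: (Vd' x).1|exact: (Wd x).1|exact: (Wd' x).1].
Qed.

(** The output law is linear in the channel, so joint convexity of the divergence applies. *)
Lemma mutinf_mix t V V' : 0 <= t <= 1 -> pos_chan V -> pos_chan V' ->
  mutinf (mixch t V V') <= t * mutinf V + (1 - t) * mutinf V'.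
Proof.
move=> t01 Vd Vd'.
have -> : mutinf (mixch t V V') =
    ckl (mixch t V V') (mixch t (fun=> outd V) (fun=> outd V')).
  rewrite /mutinf; congr ckl; apply/funext => x0; apply/funext => y.
  rewrite /outd /mixch !mulr_sumr -big_split/=; apply: eq_bigr => x _; ring.
by apply: ckl_mix => // x; exact: outd_pos.
Qed.

(** The gap between the two sides is [kl (outd V) q]. *)
Lemma mutinf_le V (q : Y -> R) : pos_chan V -> pos_dist q ->
  mutinf V <= ckl V (fun=> q).
Proof.
move=> Vd qd; rewrite -subr_ge0.
have od := outd_pos Vd.
suff -> : ckl V (fun=> q) - mutinf V = kl (outd V) q by exact: kl_ge0.
rewrite /mutinf /ckl /kl -sumrB.
under [RHS]eq_bigr do rewrite {1}/outd mulr_suml.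
rewrite exchange_big/=; apply: eq_bigr => x _.
rewrite -mulrBr -sumrB mulr_sumr; apply: eq_bigr => y _.
have V0 := (Vd x).1 y.
rewrite !ln_div ?posrE//; [ring|exact: od.1|exact: qd.1|exact: od.1|exact: qd.1].
Qed.

(** Constant channels provide the Slater point for the duality. *)
Lemma mutinf_const (u : Y -> R) : pos_dist u -> mutinf (fun=> u) = 0.
Proof.
move=> ud; rewrite /mutinf /ckl big1// => x _.
have -> : outd (fun=> u) = u.
  by apply/funext => y; rewrite /outd -mulr_suml Pd.2 mul1r.
rewrite /kl big1 ?mulr0// => y _.
by rewrite divff ?ln1 ?mulr0// gt_eqF//; exact: ud.1.
Qed.

End ConditionalDivergence.

(* Strong duality for one convex constraint, with Slater point [v0]. *)
Lemma lagrange_multiplier (R : realType) (T : Type) (S : T -> Prop) (A B : T -> R)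
    (v0 : T) (K r : R) :
  0 < r -> S v0 -> A v0 <= K -> B v0 = 0 ->
  (forall v, S v -> 0 <= A v) ->
  (forall t v v', 0 <= t <= 1 -> S v -> S v' -> exists v'',
    [/\ S v'', A v'' <= t * A v + (1 - t) * A v' &
        B v'' <= t * B v + (1 - t) * B v']) ->
  exists2 rho : R, 0 <= rho <= K / r &
  forall eps, 0 < eps -> exists v, [/\ S v, B v <= r &
    forall v', S v' -> A v <= A v' + rho * (B v' - r) + eps].
Proof.
move=> r0 Sv0 Av0 Bv0 A0 mix.
pose E := [set A v | v in [set v | S v /\ B v <= r]].
have E0 : has_inf E.
  split; first by exists (A v0), v0 => //; split => //; rewrite Bv0 ltW.
  by exists 0 => _ [v [Sv _] <-]; exact: A0.
pose h := inf E.
have hA v : S v -> B v <= r -> h <= A v.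
  by move=> Sv Bv; apply: ge_inf; [exact: E0.2|exists v].
have h0 : 0 <= h.
  by apply: lb_le_inf; [exact: E0.1|move=> _ [v [Sv _] <-]; exact: A0].
(* The multiplier is the least secant slope from strictly feasible points to the optimal value [h]
   at level [r]. *)
pose F := [set (A v - h) / (r - B v) | v in [set v | S v /\ B v < r]].
have FP z : F z -> 0 <= z.
  move=> [v [Sv Bv] <-]; rewrite divr_ge0// subr_ge0; last exact: ltW.
  by apply: hA => //; exact: ltW.
have F0 : has_inf F.
  split; last by exists 0 => z; exact: FP.
  by exists ((A v0 - h) / (r - B v0)), v0 => //; split => //; rewrite Bv0.
pose rho := inf F.
have rho0 : 0 <= rho by apply: lb_le_inf => //; exact: F0.1.
(* The secant from the Slater point bounds [rho]. *)
exists rho.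
  rewrite rho0/=; apply: (@le_trans _ _ ((A v0 - h) / (r - B v0))).
    by apply: ge_inf; [exact: F0.2|exists v0 => //; split => //; rewrite Bv0].
  by rewrite Bv0 subr0 ler_pM2r ?invr_gt0//; lra.
have key v : S v -> h <= A v + rho * (B v - r).
  move=> Sv; have [Bv|Bv|Bv] := ltgtP (B v) r.
  - have : rho <= (A v - h) / (r - B v).
      by apply: ge_inf; [exact: F0.2|exists v].
    by rewrite ler_pdivlMr ?subr_gt0//; lra.
  - have : (h - A v) / (B v - r) <= rho.
      apply: lb_le_inf; first exact: F0.1.
      move=> _ [v' [Sv' Bv'] <-].
      have d0 : 0 < B v - B v' by lra.
      (* This weight brings the mixed constraint value to exactly [r], so the mixture is feasible
         and [h] bounds its cost from below. *)
      pose t := (r - B v') / (B v - B v').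
      have tE : t * (B v - B v') = r - B v' by rewrite divfK// gt_eqF.
      have t01 : 0 <= t <= 1.
        by rewrite divr_ge0 ?ler_pdivrMr// ?mul1r; lra.
      have [v'' [Sv'' A'' B'']] := mix t v v' t01 Sv Sv'.
      have : h <= A v''.
        apply: hA => //; apply: (le_trans B''); lra.
      move=> /le_trans /(_ A'') hle.
      rewrite ler_pdivrMr ?subr_gt0// mulrAC ler_pdivlMr ?subr_gt0//.
      have := ler_wpM2r (ltW d0) hle.
      rewrite (_ : (t * A v + (1 - t) * A v') * (B v - B v') =
        t * (B v - B v') * A v + (B v - B v' - t * (B v - B v')) * A v'); last by ring.
      rewrite tE; lra.
    by rewrite ler_pdivrMr ?subr_gt0//; lra.
  - by rewrite Bv subrr mulr0 addr0; apply: hA => //; rewrite Bv.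
move=> eps eps0.
have [_ [v [Sv Bv] <-] Av] := inf_adherent eps0 E0.
exists v; split=> // v' Sv'; apply: ltW; apply: (lt_le_trans Av).
by rewrite lerD2r; exact: key.
Qed.

(** * Change of measure *)

Section ProductMeasure.
Context {R : realType} (n : nat) (Y : finType).
Implicit Types k v w q h : 'I_n -> Y -> R.

Definition prodm k (y : {ffun 'I_n -> Y}) : R := \prod_i k i (y i).

Lemma prodm_expect k h :
  \sum_y prodm k y * \prod_i h i (y i) = \prod_i \sum_z k i z * h i z.
Proof.
rewrite bigA_distr_bigA/=; apply: eq_bigr => y _.
by rewrite /prodm -big_split.
Qed.

Lemma prodm_sum1 k : (forall i, \sum_z k i z = 1) -> \sum_y prodm k y = 1.
Proof.
move=> k1; have := prodm_expect k (fun _ _ => 1).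
rewrite [RHS]big1 => [<-|i _]; last by under eq_bigr do rewrite mulr1.
by apply: eq_bigr => y _; rewrite big1 ?mulr1.
Qed.

Lemma prodm_pos k : (forall i, pos_dist (k i)) -> pos_dist (prodm k).
Proof.
move=> kd; split=> [y|]; last by apply: prodm_sum1 => i; exact: (kd i).2.
by apply: prodr_gt0 => i _; exact: (kd i).1.
Qed.

(** Coordinates are independent and centered, so cross terms vanish; each term is written as a
    product over coordinates to apply [prodm_expect]. *)
Lemma prodm_sqr_sum k h : (forall i, \sum_z k i z = 1) ->
  (forall i, \sum_z k i z * h i z = 0) ->
  \sum_y prodm k y * (\sum_i h i (y i)) ^+ 2 = \sum_i \sum_z k i z * h i z ^+ 2.
Proof.
move=> k1 h0.
rewrite (eq_bigr (fun y => \sum_i \sum_j prodm k y * (h i (y i) * h j (y j)))); last first.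
  move=> y _; rewrite expr2 big_distrlr/= mulr_sumr; apply: eq_bigr => i _.
  by rewrite mulr_sumr.
rewrite exchange_big/=; apply: eq_bigr => i _.
rewrite exchange_big/= (bigD1 i)//= [X in _ + X]big1 ?addr0; last first.
  move=> j ji.
  pose u l z := (if l == i then h i z else 1) * (if l == j then h j z else 1).
  rewrite (eq_bigr (fun y => prodm k y * \prod_l u l (y l))); last first.
    move=> y _; congr (_ * _); rewrite /u big_split/= -!big_mkcond/=.
    by rewrite !big_pred1_eq.
  rewrite prodm_expect (bigD1 i)//= [X in X * _](_ : _ = 0) ?mul0r//.
  rewrite -[RHS](h0 i); apply: eq_bigr => z _.
  by rewrite /u eqxx eq_sym (negbTE ji) mulr1.
pose u l z := if l == i then h i z ^+ 2 else 1.
rewrite (eq_bigr (fun y => prodm k y * \prod_l u l (y l))); last first.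
  by move=> y _; congr (_ * _); rewrite /u -big_mkcond/= big_pred1_eq expr2.
rewrite prodm_expect (bigD1 i)//= [X in _ * X]big1 ?mulr1; last first.
  move=> l li; rewrite -[RHS](k1 l); apply: eq_bigr => z _.
  by rewrite /u (negbTE li) mulr1.
by apply: eq_bigr => z _; rewrite /u eqxx.
Qed.

Lemma chebyshev_sum (T : finType) (p Z : T -> R) (c : R) :
  (forall t, 0 <= p t) -> 0 < c ->
  \sum_(t | c < Z t) p t <= (\sum_t p t * Z t ^+ 2) / c ^+ 2.
Proof.
move=> p0 c0; rewrite ler_pdivlMr ?exprn_gt0// mulr_suml big_mkcond/=.
apply: ler_sum => t _; case: ifPn => [cZ|_]; last by rewrite mulr_ge0 ?sqr_ge0.
by rewrite ler_wpM2l// ler_pXn2r ?nnegrE// ?ltW// (lt_trans c0).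
Qed.

(** Uncentered second moments, bounding the variance of the log-likelihood ratio under [prodm v]. *)
Definition llr2 v w : R := \sum_i \sum_z v i z * ln (v i z / w i z) ^+ 2.

(** Chebyshev for independent terms; each variance falls short of the second moment by the squared
    mean [kl (v i) (w i) ^+ 2]. *)
Lemma llr_deviation v w (l : R) : (forall i, pos_dist (v i)) -> 0 < l ->
  \sum_(y : {ffun 'I_n -> Y} |
      l < \sum_i ln (v i (y i) / w i (y i)) - \sum_i kl (v i) (w i)) prodm v y
  <= llr2 v w / l ^+ 2.
Proof.
move=> vd l0.
have vp := prodm_pos vd.
pose h i z := ln (v i z / w i z) - kl (v i) (w i).
apply: (le_trans (chebyshev_sum _ (fun y => ltW (vp.1 y)) l0)).
rewrite ler_pM2r ?invr_gt0 ?exprn_gt0//.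
rewrite (eq_bigr (fun y => prodm v y * (\sum_i h i (y i)) ^+ 2)); last first.
  by move=> y _; rewrite /h sumrB.
have h0 i : \sum_z v i z * h i z = 0.
  rewrite /h; under eq_bigr do rewrite mulrBr.
  by rewrite sumrB -mulr_suml (vd i).2 mul1r subrr.
rewrite prodm_sqr_sum//; last by move=> i; exact: (vd i).2.
apply: ler_sum => i _.
rewrite -subr_ge0 -sumrB.
rewrite (eq_bigr (fun z => 2 * kl (v i) (w i) * (v i z * h i z)
                          + kl (v i) (w i) ^+ 2 * v i z)); last first.
  by move=> z _; rewrite /h; ring.
by rewrite big_split/= -!mulr_sumr h0 (vd i).2 mulr0 add0r mulr1 sqr_ge0.
Qed.

Lemma prodm_llr v w y : (forall i z, 0 < v i z) -> (forall i z, 0 < w i z) ->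
  prodm v y = prodm w y * expR (\sum_i ln (v i (y i) / w i (y i))).
Proof.
move=> v0 w0; rewrite expR_sum /prodm -big_split/=; apply: eq_bigr => i _.
by rewrite lnK ?posrE ?divr_gt0// mulrCA divff ?mulr1// gt_eqF.
Qed.

(* Under [prodm v] both log-likelihood ratios concentrate; a set which is
   small for [prodm q] is then small for [prodm v], so that its complement
   cannot be too small for [prodm w]. *)
Lemma change_of_measure v w q (l : R) (A : pred {ffun 'I_n -> Y}) :
  (forall i, pos_dist (v i)) -> (forall i, pos_dist (w i)) ->
  (forall i, pos_dist (q i)) -> 0 < l ->
  8 * llr2 v w <= l ^+ 2 -> 8 * llr2 v q <= l ^+ 2 ->
  expR (\sum_i kl (v i) (q i) + l) * \sum_(y | A y) prodm q y <= 4^-1 ->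
  2^-1 * expR (- (\sum_i kl (v i) (w i) + l)) <= \sum_(y | ~~ A y) prodm w y.
Proof.
move=> vd wd qd l0 vw8 vq8 smallA.
set D := \sum_i kl (v i) (w i); set I := \sum_i kl (v i) (q i) in smallA *.
have vp := prodm_pos vd; have wp := prodm_pos wd; have qp := prodm_pos qd.
have v0 i z : 0 < v i z by exact: (vd i).1.
have w0 i z : 0 < w i z by exact: (wd i).1.
have q0 i z : 0 < q i z by exact: (qd i).1.
have dev u : 8 * llr2 v u <= l ^+ 2 -> llr2 v u / l ^+ 2 <= 8^-1.
  by move=> h; rewrite ler_pdivrMr ?exprn_gt0//; lra.
have dw := le_trans (llr_deviation w vd l0) (dev _ vw8).
have dq := le_trans (llr_deviation q vd l0) (dev _ vq8).
set Bw := fun y : {ffun 'I_n -> Y} => l < \sum_i ln (v i (y i) / w i (y i)) - D.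
set Bq := fun y : {ffun 'I_n -> Y} => l < \sum_i ln (v i (y i) / q i (y i)) - I.
have smallAv : \sum_(y | A y && ~~ Bq y) prodm v y <= 4^-1.
  apply: le_trans smallA; rewrite mulr_sumr [leRHS](bigID Bq)/= -[leLHS]add0r.
  apply: lerD; first by apply: sumr_ge0 => y _; rewrite mulr_ge0 ?expR_ge0// ltW ?qp.1.
  apply: ler_sum => y /andP[_ By]; rewrite (prodm_llr y v0 q0) mulrC.
  rewrite ler_pM2r ?qp.1// ler_expR; move: By; rewrite /Bq -leNgt; lra.
(* These four sets cover the space. The first three have mass at most 1/8, 1/8 and 1/4, which leaves
   1/2 for the last. *)
have total : 1 <= \sum_(y | Bw y) prodm v y + \sum_(y | Bq y) prodm v y +
   \sum_(y | A y && ~~ Bq y) prodm v y + \sum_(y | ~~ A y && ~~ Bw y) prodm v y.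
  rewrite -[1]vp.2 big_mkcond/= [X in X + _ + _ + _]big_mkcond/=.
  rewrite [X in _ + X + _ + _]big_mkcond/= [X in _ + X + _]big_mkcond/=.
  rewrite [X in _ + X]big_mkcond/= -!big_split/=; apply: ler_sum => y _.
  have := vp.1 y; case: (A y); case: (Bw y); case: (Bq y) => /=; lra.
have half : 2^-1 <= \sum_(y | ~~ A y && ~~ Bw y) prodm v y.
  by move: dw dq; rewrite -/Bw -/Bq -/D -/I; lra.
rewrite expRN ler_pdivrMr ?expR_gt0//; apply: (le_trans half).
rewrite mulr_suml [leRHS](bigID Bw)/= -[leLHS]add0r; apply: lerD.
  by apply: sumr_ge0 => y _; rewrite mulr_ge0 ?expR_ge0// ltW ?wp.1.
apply: ler_sum => y /andP[_ By]; rewrite (prodm_llr y v0 w0).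
rewrite ler_pM2l ?wp.1// ler_expR; move: By; rewrite /Bw -leNgt; lra.
Qed.

End ProductMeasure.

(** * Sphere packing *)

(** Pigeonhole: otherwise every fiber has size times [#|T|] at most [#|I| - 1], and summing over [T]
    is absurd. *)
Lemma exists_large_fiber (I T : finType) (f : I -> T) (i0 : I) :
  exists i, (#|I| <= #|T| * #|[pred j | f j == f i]|)%N.
Proof.
apply: contrapT => small.
have fib t : (#|T| * #|[pred j | f j == t]| <= #|I|.-1)%N.
  have [/existsP[i /eqP <-]|/existsPn none] := boolP [exists i, f i == t].
    rewrite -ltnS prednK; last by apply/card_gt0P; exists i0.
    by rewrite ltnNge; apply/negP => h; apply: small; exists i.
  by rewrite [X in (_ * X)%N]eq_card0 ?muln0// => j; rewrite !inE (negbTE (none j)).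
have cardI : (\sum_t #|[pred j | f j == t]| = #|I|)%N.
  rewrite -[RHS]sum1_card (partition_big f xpredT)//=; apply: eq_bigr => t _.
  by rewrite -sum1_card; apply: eq_bigl => j; rewrite !inE.
have : (#|T| * #|I| <= #|T| * #|I|.-1)%N.
  rewrite -[in leqLHS]cardI big_distrr/= -sum_nat_const; exact: leq_sum.
rewrite leq_pmul2l; last by apply/card_gt0P; exists (f i0).
have : (0 < #|I|)%N by apply/card_gt0P; exists i0.
by case: #|I| => // k _; rewrite ltnn.
Qed.

(** At the square root of [n] this bounds [n + 1], so the polynomial number of types costs only
    O(sqrt n) in the exponent. *)
Lemma expR_ge1D_sqr (R : realType) (x : R) : 0 <= x -> 1 + x ^+ 2 <= expR (2 * x).
Proof.
move=> x0; have h := expR_ge1Dx x.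
rewrite expRM_natl; nra.
Qed.

(** * Error bound for a single code *)

Section CodeBound.
Context {R : realType} (X Y : finType) (W : X -> Y -> R) (K : R).
Hypothesis Wd : pos_chan W.
Hypothesis W_lb : forall x y, `|ln (W x y)| <= K.

(** A common bound for two second moments: [8 * #|Y| + 2 * K ^+ 2] against [W] and [16 * #|Y|]
    against the output law. *)
Definition llr_bound : R := 16 * #|Y|%:R + 2 * K ^+ 2.

Lemma weighted_sqr_ln_ratio (u v : R) : 0 < u <= 1 -> 0 < v ->
  u * ln (u / v) ^+ 2 <= 8 + 2 * (u * ln v ^+ 2).
Proof.
move=> u01 v0; have /andP[u0 u1] := u01.
rewrite ln_div ?posrE//; have := sqr_ln_le u01.
have := sqr_ge0 (ln u + ln v); nra.
Qed.

Lemma llr2_channel_le (v : Y -> R) x : pos_dist v ->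
  \sum_y v y * ln (v y / W x y) ^+ 2 <= llr_bound.
Proof.
move=> vd; have v0 := vd.1.
apply: (@le_trans _ _ (\sum_y (8 + 2 * K ^+ 2 * v y))).
  apply: ler_sum => y _.
  have v01 : 0 < v y <= 1 by rewrite v0 dist_le1//; exact: pos_distW.
  apply: (le_trans (weighted_sqr_ln_ratio v01 ((Wd x).1 y))).
  have : ln (W x y) ^+ 2 <= K ^+ 2.
    by rewrite -real_normK ?num_real// lerXn2r ?nnegrE// (le_trans _ (W_lb x y)).
  have := v0 y; nra.
rewrite big_split/= -mulr_sumr vd.2 sumr_const/= -mulr_natr /llr_bound.
have : 0 <= #|Y|%:R :> R by [].
rewrite cardT -cardE; lra.
Qed.

(** The output law has no uniform lower bound, but averaging over [x] weights its squared logarithm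
    by the output law itself, so [sqr_ln_le] applies. *)
Lemma llr2_output_le (P : X -> R) (V : X -> Y -> R) : is_dist P -> pos_chan V ->
  \sum_x P x * \sum_y V x y * ln (V x y / outd P V y) ^+ 2 <= llr_bound.
Proof.
move=> Pd Vd; have qd := outd_pos Pd Vd.
apply: (@le_trans _ _ (\sum_x P x * \sum_y (8 + 2 * (V x y * ln (outd P V y) ^+ 2)))).
  apply: ler_sum => x _; rewrite ler_wpM2l//; first exact: Pd.1.
  apply: ler_sum => y _; apply: weighted_sqr_ln_ratio; last exact: qd.1.
  by rewrite (Vd x).1 dist_le1//; exact: pos_distW.
under eq_bigr do rewrite mulr_sumr.
rewrite exchange_big/=.
apply: (@le_trans _ _ (\sum_(y : Y) 16)).
  apply: ler_sum => y _.
  rewrite (eq_bigr (fun x => 8 * P x + 2 * ln (outd P V y) ^+ 2 * (P x * V x y))); last first.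
    by move=> x _; ring.
  rewrite big_split/= -!mulr_sumr Pd.2 -/(outd P V y).
  have q01 : 0 < outd P V y <= 1 by rewrite qd.1 dist_le1//; exact: pos_distW.
  have := sqr_ln_le q01; lra.
rewrite sumr_const/= -mulr_natr /llr_bound.
have := sqr_ge0 K; rewrite cardT -cardE; lra.
Qed.

(** Being at least 1 and at least [8 * llr_bound], its square dominates [8 * llr_bound], as the
    Chebyshev bounds require. *)
Definition dev_const : R := 1 + 8 * llr_bound.

(** The summands pay for the deviation, the number of types and the factor 1/4, in this order. *)
Definition rate_const : R := dev_const + 2 * #|X|%:R + 2.

Lemma llr_bound_ge0 : 0 <= llr_bound.
Proof.
rewrite /llr_bound; have := sqr_ge0 K; have : 0 <= #|Y|%:R :> R by [].
lra.
Qed.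

(** [P] is the type of a large class of codewords and is fixed before [V]; the bad message may
    depend on [V], which the maximum in [Pemax] hides. *)
Lemma Pemax_ge_exp_ckl (Rate : R) (n N : nat)
    (enc : 'I_N -> {ffun 'I_n -> X}) (dec : {ffun 'I_n -> Y} -> 'I_N) :
  (0 < n)%N -> expR (n%:R * Rate) <= N%:R ->
  exists2 P : X -> R, is_dist P &
  forall V, pos_chan V -> mutinf P V <= Rate - rate_const / Num.sqrt n%:R ->
  2^-1 * expR (- (n%:R * ckl P V W + dev_const * Num.sqrt n%:R)) <= Pemax W enc dec.
Proof.
move=> n0 NR.
have N0 : (0 < N)%N.
  by rewrite -(ltr_nat R); apply: lt_le_trans NR; exact: expR_gt0.
have n0R : 0 < n%:R :> R by rewrite ltr0n.
set sn := Num.sqrt (n%:R : R).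
have sn0 : 0 < sn by rewrite sqrtr_gt0.
have snE : sn ^+ 2 = n%:R by rewrite sqr_sqrtr// ltW.
have sn1 : 1 <= sn by rewrite -sqrtr1 ler_wsqrtr// ler1n.
pose ty (m : 'I_N) : {ffun X -> 'I_n.+1} :=
  [ffun x => inord #|[pred i | enc m i == x]|].
have tyE m x : ty m x = #|[pred i | enc m i == x]| :> nat.
  rewrite ffunE inordK// ltnS; apply: leq_trans (max_card _) _.
  by rewrite card_ord.
have [m0 big_fiber] := exists_large_fiber ty (Ordinal N0).
rewrite card_ord card_ffun card_ord in big_fiber.
set S := [pred j | ty j == ty m0] in big_fiber.
have S0 : (0 < #|S|)%N by apply/card_gt0P; exists m0; rewrite inE.
pose P x : R := (ty m0 x)%:R / n%:R.
have sum_type m (F : X -> R) : m \in S ->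
    \sum_i F (enc m i) = n%:R * \sum_x P x * F x.
  rewrite inE => /eqP mS.
  rewrite (partition_big (enc m) xpredT)//= mulr_sumr; apply: eq_bigr => x _.
  rewrite (eq_bigr (fun=> F x)); last by move=> i /eqP ->.
  rewrite sumr_const /P mulrA mulrCA mulfV ?gt_eqF// mulr1 mulr_natl.
  congr (_ *+ _); rewrite -mS tyE; apply: eq_card => i.
  by rewrite !inE.
have Pd : is_dist P.
  split=> [x|]; first by rewrite divr_ge0.
  have m0S : m0 \in S by rewrite inE.
  have := sum_type m0 (fun=> 1) m0S.
  rewrite sumr_const card_ord => /eqP; under eq_bigr do rewrite mulr1.
  rewrite -[n%:R in X in X == _]mulr1 => /eqP /(mulfI (lt0r_neq0 n0R)).
  by [].
exists P => // V Vd IV.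
have qd := outd_pos Pd Vd.
pose Q y := prodm (fun _ : 'I_n => outd P V) y.
have Qd : pos_dist Q by exact: prodm_pos.
(* Decoding regions are disjoint, so the average [Q]-mass over the class is at most [1 / #|S|]. *)
have [m mS mQ] : exists2 m, m \in S & \sum_(y | dec y == m) Q y <= #|S|%:R^-1.
  apply: contrapT => none.
  have gtS m : m \in S -> #|S|%:R^-1 < \sum_(y | dec y == m) Q y.
    by move=> mS; rewrite ltNge; apply/negP => h; apply: none; exists m.
  have : \sum_(m in S) #|S|%:R^-1 < \sum_(m in S) \sum_(y | dec y == m) Q y.
    apply: ltr_sum => //; apply/hasP; exists m0; first exact: mem_index_enum.
    by rewrite inE.
  apply/negP; rewrite -leNgt sumr_const -[leRHS]mulr_natl divff; last first.
    by rewrite pnatr_eq0 -lt0n.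
  rewrite -Qd.2 (partition_big dec xpredT)//= [leRHS](bigID (mem S))/= lerDl.
  by apply: sumr_ge0 => m _; apply: sumr_ge0 => y _; rewrite ltW// Qd.1.
apply: (@le_trans _ _ (Pe_m W enc dec m)); last exact: le_bigmax.
have dc1 : 1 <= dev_const by rewrite lerDl mulr_ge0// llr_bound_ge0.
have l0 : 0 < dev_const * sn by rewrite mulr_gt0//; lra.
have l2 (z : R) : z <= n%:R * llr_bound -> 8 * z <= (dev_const * sn) ^+ 2.
  move=> zn; rewrite exprMn snE.
  have : n%:R * (8 * llr_bound) <= n%:R * dev_const ^+ 2.
    by rewrite ler_pM2l// /dev_const; have := llr_bound_ge0; nra.
  lra.
have -> : n%:R * ckl P V W = \sum_i kl (V (enc m i)) (W (enc m i)).
  by rewrite (sum_type m (fun x => kl (V x) (W x)) mS).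
have IE : n%:R * mutinf P V = \sum_i kl (V (enc m i)) (outd P V).
  by rewrite (sum_type m (fun x => kl (V x) (outd P V)) mS).
apply: (@change_of_measure _ n Y (fun i => V (enc m i)) (fun i => W (enc m i))
  (fun=> outd P V) _ (fun y => dec y == m)) => //.
- apply: l2; rewrite /llr2.
  apply: (@le_trans _ _ (\sum_(i < n) llr_bound)).
    by apply: ler_sum => i _; exact: llr2_channel_le.
  by rewrite sumr_const card_ord mulr_natl.
- apply: l2; rewrite /llr2.
  rewrite (sum_type m (fun x => \sum_y V x y * ln (V x y / outd P V y) ^+ 2) mS).
  by rewrite ler_pM2l//; exact: llr2_output_le.
- rewrite -IE; apply: (@le_trans _ _
    (expR (n%:R * mutinf P V + dev_const * sn) * #|S|%:R^-1)).
    by rewrite ler_wpM2l// expR_ge0.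
  have S0R : 0 < #|S|%:R :> R by rewrite ltr0n.
  rewrite ler_pdivrMr//.
  have types : (n.+1 ^ #|X|)%:R <= expR (2 * #|X|%:R * sn) :> R.
    rewrite natrX -mulrA mulrCA expRM_natl lerXn2r ?nnegrE ?expR_ge0//.
    by rewrite -natr1 addrC -snE expR_ge1D_sqr// ltW.
  have four : 4 <= expR (2 * sn).
    apply: (@le_trans _ _ (expR (2 * 1))); last by rewrite ler_expR ler_pM2l.
    by rewrite expRM_natl; have := expR_ge1Dx (1 : R); nra.
  have NS : expR (n%:R * Rate) <= expR (2 * #|X|%:R * sn) * #|S|%:R.
    apply: (le_trans NR); apply: (@le_trans _ _ ((n.+1 ^ #|X|)%:R * #|S|%:R)).
      by rewrite -natrM ler_nat.
    by rewrite ler_pM2r.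
  have IV' : n%:R * mutinf P V <= n%:R * Rate - rate_const * sn.
    have := ler_wpM2l (ltW n0R) IV.
    rewrite mulrBr (_ : n%:R * (rate_const / sn) = rate_const * sn)//.
    by rewrite -snE; field; rewrite gt_eqF.
  apply: (@le_trans _ _ (expR (n%:R * Rate - (2 * #|X|%:R * sn + 2 * sn)))).
    by rewrite ler_expR; move: IV'; rewrite /rate_const; lra.
  rewrite expRD expRN expRD ler_pdivrMr ?mulr_gt0 ?expR_gt0//.
  apply: (le_trans NS); rewrite [4^-1 * _]mulrC mulrACA [#|S|%:R * _]mulrC.
  by rewrite -[leLHS]mulr1 ler_pM2l ?mulr_gt0 ?expR_gt0//; lra.
Qed.

End CodeBound.

(** * From power means to the f-divergence exponent *)

Section FSpherePacking.
Context {R : realType}.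
Variables (a b : R) (psi : R -> R -> R).

Definition admissible (s : R) : Prop :=
  [/\ (forall t : R, a <= psi s t <= b),
      psi s 0 = 1,
      (forall x : R, 0 < x ->
         [/\ derivable (fs psi s) x 1, derivable (derive1 (fs psi s)) x 1,
             derivable (gs psi s) x 1 & derivable (derive1 (gs psi s)) x 1]),
      (forall x : R, 0 < x -> 0 <= gs psi s x) &
      (forall x alpha : R, 0 < x -> 0 < alpha ->
         x ^+ 2 * derive1n 2 (gs psi s) x + gs psi s alpha * gs psi s (x / alpha)
           <= 0)].

(** The ratio [q / p] has mean one under [p], so tensorization applies; positivity allows taking
    logarithms. *)
Lemma expect_fs_bounds (T : finType) (s : R) (p q : T -> R) :
  0 < a -> admissible s -> pos_dist p -> pos_dist q ->
  0 < \sum_y p y * fs psi s (q y / p y) <= \sum_y p y * powR (q y / p y) s.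
Proof.
move=> a0 [psi_ab psi0 dfg _ ineq] [p0 p1] [q0 q1].
have pd : is_dist p by exact: pos_distW.
have qp0 y : 0 < q y / p y by rewrite divr_gt0.
have fs_lb (x : R) : 0 < x -> 0 < fs psi s x.
  move=> x0; rewrite mulr_gt0 ?powR_gt0//.
  by have /andP[/(lt_le_trans a0)] := psi_ab (ln x).
apply/andP; split; first by apply: expect_gt0 => // y; exact: fs_lb.
have dP (h : R -> R) : (forall x, 0 < x -> derivable h x 1) ->
    forall x : R, 0 < x -> is_derive x 1 h (derive1 h x).
  by move=> dh x x0; rewrite derive1E; apply: derivableP; exact: dh.
have df := dP _ (fun x x0 => let: And4 d _ _ _ := dfg x x0 in d).
have df1 := dP _ (fun x x0 => let: And4 _ d _ _ := dfg x x0 in d).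
have dg := dP _ (fun x x0 => let: And4 _ _ d _ := dfg x x0 in d).
have dg1 := dP _ (fun x x0 => let: And4 _ _ _ d := dfg x x0 in d).
have gE (x : R) : 0 < x -> gs psi s x = - (x ^+ 2 * derive1 (derive1 (fs psi s)) x).
  by [].
have f1 : fs psi s 1 = 1 by rewrite /fs powR1 ln1 psi0 mulr1.
have fb (x : R) : 0 < x -> 0 <= fs psi s x <= b * powR x s.
  move=> x0; rewrite ltW ?fs_lb//= /fs mulrC ler_wpM2r ?powR_ge0//.
  by have /andP[] := psi_ab (ln x).
have qpE : \sum_y p y * (q y / p y) = 1.
  by rewrite -[RHS]q1; apply: eq_bigr => y _; rewrite mulrCA divff ?mulr1// gt_eqF.
exact: (expect_f_le_powR df df1 dg dg1 gE ineq f1 fb pd qp0 qpE).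
Qed.

(** Unfolding [ftilde] gives divergence [1 - E f_s(q/W)], so [Gfun] turns it into [- ln E f_s(q/W)],
    which is at least [- ln E (q/W)^s]. *)
Lemma le_IGh (X Y : finType) (W : X -> Y -> R) (P : X -> R) (s L : R) :
  0 < a -> admissible s -> pos_chan W -> is_dist P ->
  (forall q, pos_dist q ->
     L <= \sum_x P x * - ln (\sum_y W x y * powR (q y / W x y) s)) ->
  (L%:E <= IGh (@Gfun R) (ftilde psi s) P W)%E.
Proof.
move=> a0 sP Wd Pd hL; apply: le_ereal_inf_tmp => _ [q [qd qW] <-].
have [x0 Px0] : exists x, 0 < P x.
  apply: contrapT => none; have := Pd.2; rewrite big1 => [/eqP|x _].
    by rewrite eq_sym oner_eq0.
  apply/eqP; rewrite eq_le Pd.1 andbT leNgt; apply/negP => Px.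
  by apply: none; exists x.
(* Domination of one row of the positive channel forces [q] to have full support. *)
have q0 y : 0 < q y.
  rewrite lt_neqAle qd.1 andbT; apply/eqP => /esym/(qW _ Px0)/eqP.
  by rewrite gt_eqF//; exact: (Wd x0).1.
have qp : pos_dist q by split=> //; exact: qd.2.
rewrite lee_fin; apply: (le_trans (hL q qp)); apply: ler_sum => x _.
rewrite ler_wpM2l//; first exact: Pd.1.
have W0 y : 0 < W x y by exact: (Wd x).1.
have -> : Dh (ftilde psi s) (W x) q = 1 - \sum_y W x y * fs psi s (q y / W x y).
  rewrite -(Wd x).2 -sumrB; apply: eq_bigr => y _.
  rewrite gt_eqF// /ftilde invf_div mulrA [q y * _]mulrCA divff ?gt_eqF//.
  by rewrite mulr1 mulrBr mulr1.
have /andP[f0 f1] := expect_fs_bounds a0 sP (Wd x) qp.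
rewrite /Gfun opprB addrC subrK lerN2 ler_ln ?posrE//.
exact: lt_le_trans f1.
Qed.

(** A real [L] below all the sums stands in for the infimum over output laws, which keeps the
    estimate within the reals. *)
Lemma Pemax_gt_finite_exponent (X Y : finType) (W : X -> Y -> R) (Rate : R) :
  pos_chan W -> 0 < Rate ->
  exists (C : R) (n0 : nat), 0 <= C /\
  forall (n N : nat) (enc : 'I_N -> {ffun 'I_n -> X})
         (dec : {ffun 'I_n -> Y} -> 'I_N),
  (n0 <= n)%N -> expR (n%:R * Rate) <= N%:R -> exists (P : X -> R) (s L : R),
  [/\ is_dist P, 0 < s < 1,
      (forall q, pos_dist q ->
         L <= \sum_x P x * - ln (\sum_y W x y * powR (q y / W x y) s)) &
      expR (- (n%:R * ((1 - s)^-1 * L - s / (1 - s) * Rate + C / Num.sqrt n%:R)))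
        < Pemax W enc dec].
Proof.
move=> Wd R0.
pose K : R := \sum_x \sum_y `|ln (W x y)|.
have WK x y : `|ln (W x y)| <= K.
  rewrite /K (bigD1 x)//= (bigD1 y)//= -addrA lerDl.
  by rewrite addr_ge0 ?sumr_ge0// => ? _; rewrite sumr_ge0.
have K0 : 0 <= K by apply: sumr_ge0 => x _; apply: sumr_ge0.
pose c : R := dev_const Y K; pose c' : R := rate_const X Y K.
have c0 : 0 <= c by rewrite /c /dev_const addr_ge0// mulr_ge0// llr_bound_ge0.
have c'0 : 0 <= c'
  by have : 0 <= #|X|%:R :> R by []; rewrite /c' /rate_const -/c; lra.
(* In order: the deviation, the rate loss times the bound on [rho], the duality slack, the shift of
   [rho], and the factor 1/2. *)
pose C : R := c + 2 * K / Rate * c' + 1 + Rate + 2.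
(* Once the square root of [n] exceeds [M], the reduced rate [Rn] is at least [Rate / 2]. *)
pose M : R := 2 * c' / Rate.
have M0 : 0 <= M by rewrite divr_ge0 ?mulr_ge0// ltW.
exists C, (Num.truncn (M ^+ 2)).+1; split.
  have : 0 <= 2 * K / Rate * c' by rewrite !mulr_ge0 ?invr_ge0// ltW.
  by rewrite /C; lra.
move=> n N enc dec n0n NR.
have n0 : (0 < n)%N by exact: leq_trans n0n.
have n0R : 0 < n%:R :> R by rewrite ltr0n.
set sn := Num.sqrt (n%:R : R).
have sn0 : 0 < sn by rewrite sqrtr_gt0.
have snE : sn ^+ 2 = n%:R by rewrite sqr_sqrtr// ltW.
have sn1 : 1 <= sn by rewrite -sqrtr1 ler_wsqrtr// ler1n.
have Msn : M <= sn.
  have sn_ge0 := ltW sn0.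
  rewrite ltW// -(ltr_pXn2r (n := 2)) ?nnegrE// snE.
  apply: (@lt_le_trans _ _ (Num.truncn (M ^+ 2)).+1%:R); first exact: truncnS_gt.
  by rewrite ler_nat.
pose Rn := Rate - c' / sn.
have Rn_half : Rate / 2 <= Rn.
  suff : c' / sn <= Rate / 2 by rewrite /Rn; lra.
  rewrite ler_pdivrMr//.
  by move: Msn; rewrite /M ler_pdivrMr//; lra.
have Rn0 : 0 < Rn by lra.
have [P Pd boundP] := Pemax_ge_exp_ckl Wd WK enc dec n0 NR.
have x0 : X.
  have N0 : (0 < N)%N.
    by rewrite -(ltr_nat R); apply: lt_le_trans NR; exact: expR_gt0.
  exact: (enc (Ordinal N0) (Ordinal n0)).
have ckl0 : ckl P (fun=> W x0) W <= K.
  rewrite /ckl -[leRHS]mul1r -Pd.2 mulr_suml; apply: ler_sum => x _.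
  rewrite ler_wpM2l//; first exact: Pd.1.
  rewrite /kl -[leRHS]mul1r -(Wd x0).2 mulr_suml; apply: ler_sum => y _.
  have W0 := (Wd x0).1 y; rewrite ler_wpM2l//; first exact: ltW.
  rewrite ln_div ?posrE ?(Wd _).1//.
  have : ln (W x0 y) <= 0 by apply: ln_le0; rewrite dist_le1//; exact: pos_distW.
  by have := WK x y; rewrite ler_norml => /andP[]; lra.
have Vmix t V V' : 0 <= t <= 1 -> pos_chan V -> pos_chan V' -> exists V'',
    [/\ pos_chan V'', ckl P V'' W <= t * ckl P V W + (1 - t) * ckl P V' W &
        mutinf P V'' <= t * mutinf P V + (1 - t) * mutinf P V'].
  move=> t01 Vd Vd'; exists (mixch t V V'); split.
  - exact: mixch_pos.
  - have := ckl_mix Pd t01 Vd Vd' Wd Wd.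
    rewrite (_ : mixch t W W = W)//; apply/funext => x; apply/funext => y.
    by rewrite /mixch; ring.
  - exact: mutinf_mix.
have Wx0 : @pos_chan R X Y (fun=> W x0).
  by move=> x; exact: (Wd x0).
have [rho /andP[rho0 rhoK] dual] := lagrange_multiplier Rn0 Wx0 ckl0
  (mutinf_const Pd (Wd x0)) (fun V (Vd : pos_chan V) => ckl_ge0 Pd Vd Wd) Vmix.
have tau0 : 0 < sn^-1 by rewrite invr_gt0.
have [V [Vd VI VD]] := dual _ tau0.
(* Shifting the multiplier keeps [s] away from 0, which is excluded in [Efsp]. *)
pose rho' := rho + sn^-1.
have rho'0 : 0 < rho' by rewrite ltr_wpDl.
pose s := rho' / (1 + rho').
have rho1 : 1 + rho' != 0 by rewrite gt_eqF// addr_gt0.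
have s1E : 1 - s = (1 + rho')^-1 by rewrite /s; field.
have s01 : 0 < s < 1.
  apply/andP; split; first by rewrite divr_gt0// addr_gt0.
  by rewrite -subr_gt0 s1E invr_gt0 addr_gt0.
have sE : s / (1 - s) = rho' by rewrite s1E invrK /s divfK.
pose D := ckl P V W.
(* Duality bounds [D + rho * Rn - sn^-1] by [ckl v W + rho * mutinf v]. Raising [rho] to [rho'] and
   [mutinf] to the divergence from [q] only increases this, and for the tilted [v] it becomes the
   Gibbs value. *)
exists P, s, ((1 - s) * (D + rho * Rn - sn^-1)); split => //.
  move=> q qd.
  have [v vP] := choice (fun x =>
    let: ex_intro2 v vd vE := kl_tilt s01 (Wd x) qd in
    ex_intro (fun v => pos_dist v /\ kl v (W x) + s / (1 - s) * kl v q =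
    (1 - s)^-1 * - ln (\sum_y W x y * powR (q y / W x y) s)) v (conj vd vE)).
  have vd : pos_chan v by move=> x; have [] := vP x.
  have s1 : 0 < 1 - s by rewrite s1E invr_gt0 addr_gt0.
  rewrite -ler_pdivlMl// mulr_sumr.
  rewrite (eq_bigr (fun x => P x * kl (v x) (W x) + rho' * (P x * kl (v x) q))); last first.
    by move=> x _; rewrite mulrCA -(vP x).2 sE; ring.
  rewrite big_split/= -mulr_sumr -/(ckl P v W) -/(ckl P v (fun=> q)).
  have h1 := VD v vd.
  have h2 := mutinf_le Pd vd qd.
  have h3 : 0 <= mutinf P v by apply: ckl_ge0 => // x; exact: outd_pos.
  have h4 := ler_wpM2l (ltW rho'0) h2.
  have h5 : 0 <= sn^-1 * mutinf P v by rewrite mulr_ge0// ltW.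
  by move: h4; rewrite /rho' mulrDl -/D in h1 *; lra.
have := boundP V Vd VI; rewrite -/sn -/c -/D; apply: lt_le_trans.
have s1 : 1 - s != 0 by rewrite s1E invr_eq0.
rewrite mulKf// sE.
have rhoB : rho * c' <= 2 * K / Rate * c'.
  rewrite ler_wpM2r//; apply: (le_trans rhoK).
  rewrite ler_pdivrMr// mulrAC ler_pdivlMr//.
  by have := ler_wpM2l K0 Rn_half; lra.
have nE : n%:R * (D + rho * Rn - sn^-1 - rho' * Rate + C / sn) =
    n%:R * D + (C - rho * c' - 1 - Rate) * sn.
  by rewrite -snE /Rn /rho'; field; rewrite gt_eqF.
rewrite nE.
apply: (@le_lt_trans _ _ (expR (- (n%:R * D + c * sn) - 1))).
  rewrite ler_expR.
  have : (c + 2) * sn <= (C - rho * c' - 1 - Rate) * sn.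
    by rewrite ler_pM2r// /C; lra.
  lra.
rewrite expRD mulrC ltr_pM2r ?expR_gt0// expRN ltf_pV2 ?posrE ?expR_gt0//.
by apply: expR_gt1Dx; rewrite oner_eq0.
Qed.

End FSpherePacking.

(** * Passage to the extended-real exponent and to the limit superior *)

Theorem theorem9 (R : realType) (a b : R) (psi : R -> R -> R)
  (X Y : finType) (W : X -> Y -> R) (Rate : R) :
  0 < a -> a < b ->
  (forall s : R, 0 < s < 1 ->
     [/\ (forall t : R, a <= psi s t <= b),
         psi s 0 = 1,
         (forall x : R, 0 < x ->
            [/\ derivable (fs psi s) x 1, derivable (derive1 (fs psi s)) x 1,
                derivable (gs psi s) x 1 & derivable (derive1 (gs psi s)) x 1]),
         (forall x : R, 0 < x -> 0 <= gs psi s x) &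
         (forall x alpha : R, 0 < x -> 0 < alpha ->
            x ^+ 2 * derive1n 2 (gs psi s) x + gs psi s alpha * gs psi s (x / alpha)
              <= 0)]) ->
  (forall x, is_dist (W x)) ->
  (forall x y, 0 < W x y) ->
  0 < Rate ->
  (exists (C1 C2 : R) (n0 : nat),
     forall (n N : nat) (enc : 'I_N -> {ffun 'I_n -> X})
            (dec : {ffun 'I_n -> Y} -> 'I_N),
       (n0 <= n)%N -> expR (n%:R * Rate) <= N%:R ->
       (expeR (- (n%:R%:E * (Efsp psi W (Rate - C1 / n%:R)
                              + (C2 / Num.sqrt n%:R)%:E)))
          < (Pemax W enc dec)%:E)%E)
  /\ (err_exp W Rate <= Efsp psi W Rate)%E.
Proof.
move=> a0 ab psiP Wdist W0 R0.
have Wd : pos_chan W by move=> x; split=> //; exact: (Wdist x).2.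
have [C [n0 [C0 bound]]] := Pemax_gt_finite_exponent Wd R0.
have main (n N : nat) (enc : 'I_N -> {ffun 'I_n -> X})
    (dec : {ffun 'I_n -> Y} -> 'I_N) :
    (n0 <= n)%N -> expR (n%:R * Rate) <= N%:R ->
    (expeR (- (n%:R%:E * (Efsp psi W Rate + (C / Num.sqrt n%:R)%:E)))
      < (Pemax W enc dec)%:E)%E.
  move=> n0n NR; have [P [s [L [Pd s01 hL Plt]]]] := bound n N enc dec n0n NR.
  have s1 : 0 < 1 - s by rewrite subr_gt0; case/andP: s01.
  have LE : (((1 - s)^-1 * L - s / (1 - s) * Rate)%:E <= Efsp psi W Rate)%E.
    apply: le_ereal_sup_tmp; exists ((1 - s)^-1%:E * IGh (@Gfun R) (ftilde psi s) P W
              - (s / (1 - s) * Rate)%:E)%E; first by exists P, s; split.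
    rewrite EFinB EFinM leeB// lee_wpmul2l//.
      by rewrite lee_fin invr_ge0 ltW.
    exact: (le_IGh a0 (psiP s s01)).
  apply: (@le_lt_trans _ _ (expeR (- (n%:R * ((1 - s)^-1 * L - s / (1 - s) * Rate
     + C / Num.sqrt n%:R)))%:E)).
    rewrite lee_expeR EFinN leeN2 EFinM lee_wpmul2l ?lee_fin//.
    by rewrite EFinD leeD2r.
  by rewrite /= lte_fin.
split.
  exists 0, C, n0 => n N enc dec n0n NR.
  by rewrite mul0r subr0; exact: main.
apply/lee_addgt0Pr => e e0.
rewrite /err_exp /limn_esup limf_esupE; apply: ge_ereal_inf.
(* Beyond [n1] the term [C / sqrt n] is at most [e]; a single tail bounds the limit superior. *)
pose n1 := maxn n0 (Num.truncn ((C / e) ^+ 2)).+1.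
exists (ereal_sup [set best_exp W Rate n | n in [set n | (n1 <= n)%N]]).
  by exists [set n | (n1 <= n)%N] => //; exists n1.
apply: ge_ereal_sup => _ [n /= n1n <-].
have /andP[n0n en] : (n0 <= n)%N && ((Num.truncn ((C / e) ^+ 2)).+1 <= n)%N.
  by rewrite -geq_max.
have np : (0 < n)%N by exact: leq_trans en.
have n0R : 0 < n%:R :> R by rewrite ltr0n.
have sn0 : 0 < Num.sqrt n%:R :> R by rewrite sqrtr_gt0.
have Ce : C / Num.sqrt n%:R <= e.
  rewrite ler_pdivrMr// mulrC -ler_pdivrMr//.
  have Ce0 : 0 <= C / e by rewrite divr_ge0// ltW.
  rewrite ltW// -(ltr_pXn2r (n := 2)) ?nnegrE ?sqrtr_ge0// sqr_sqrtr//.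
  apply: (@lt_le_trans _ _ (Num.truncn ((C / e) ^+ 2)).+1%:R); first exact: truncnS_gt.
  by rewrite ler_nat.
apply: ge_ereal_sup => _ [N [enc [dec [NR ->]]]].
have := main n N enc dec n0n NR.
(* For a finite exponent the strict bound makes [Pemax] positive, so its logarithm is genuine. The
   value -oo would put +oo below [Pemax]. *)
move: (Efsp psi W Rate) => [E| |] /=.
- rewrite lte_fin -EFinD lee_fin => h.
  have Pp : 0 < Pemax W enc dec by apply: lt_trans h; exact: expR_gt0.
  move: h; rewrite -{1}(@lnK _ (Pemax W enc dec)) ?posrE// ltr_expR => h.
  rewrite ler_pdivrMr// mulrC.
  have := ler_wpM2l (ltW n0R) Ce; lra.
- by rewrite leey.
- by rewrite mulrNy gtr0_sg// mul1e/= ltNge leey.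
Qed.
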